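(* Let $a,b\in\mathbb{C}$. For any $d_P,d_Q\in\mathbb{N}$ we have $$N(d_P,d_Q,a,b)\le d_Q+3(d_P-1)^2 .$$ Similarly, for any $d_P,d_q\in\mathbb{N}$ we have $$\widetilde N(d_P,d_q,a,b)\le 2+d_q+3(d_P-1)^2 .$$ Here $N$ and $\widetilde N$ denote the moment Bautin indices defined in the context.
   Context: Fix $a,b\in\mathbb{C}$. For polynomials $P,Q\in\mathbb{C}[z]$ with derivatives $p=P'$, $q=Q'$, define for $k=0,1,2,\dots$ the moments $$m_k(P,Q)=\int_a^b P^k(z)Q(z)p(z)\,dz,\qquad \widetilde m_k(P,q)=\int_a^b P^k(z)q(z)\,dz .$$ The vanishing index $N(P,Q,a,b)$ is the first index $k$ such that $m_k(P,Q)\ne0$, or $\infty$ if no such $k$ exists. The moment Bautin index is $$N(d_P,d_Q,a,b)=\sup\{N(P,Q,a,b)+1:\ \deg P\le d_P,\ \deg Q\le d_Q,\ N(P,Q,a,b)<\infty\},$$ i.e. the least $k\in\mathbb{N}$ such that $N(P,Q,a,b)\ge k$ implies $N(P,Q,a,b)=\infty$ for all $P,Q$ with $\deg P\le d_P$ and $\deg Q\le d_Q$. Analogously, for polynomials $P,q\in\mathbb{C}[z]$, $\widetilde N(P,q,a,b)$ is the first index $k$ such that $\widetilde m_k(P,q)\neq0$ (or $\infty$ if none exists), and $$\widetilde N(d_P,d_q,a,b)=\sup\{\widetilde N(P,q,a,b)+1:\ \deg P\le d_P,\ \deg q\le d_q,\ \widetilde N(P,q,a,b)<\infty\}.$$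
   Formalization: The first inequality is stated only for d_P ≠ 1, since at d_P = 1 it fails whenever a ≠ b (e.g. a=0, b=1, P=z, Q=1, d_Q=0 gives index at least 1 > 0); the second inequality is stated for all d_P, d_q. *)

(* Defs.v *)
From mathcomp Require Import all_boot all_order all_algebra.
From mathcomp Require Import complex.
From mathcomp Require Import all_classical all_reals all_analysis.

Set Implicit Arguments.
Unset Strict Implicit.
Unset Printing Implicit Defensive.

Import Order.TTheory GRing.Theory Num.Theory.

Local Open Scope classical_set_scope.
Local Open Scope complex_scope.
Local Open Scope ring_scope.

(* The field of complex numbers is R[i] for R : realType. *)

Definition integral01 (R : realType) (f : R -> R[i]) : R[i] :=
  (\int[lebesgue_measure]_(t in `[0, 1]) complex.Re (f t))%R +i*
  (\int[lebesgue_measure]_(t in `[0, 1]) complex.Im (f t))%R.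

(* Integral along the segment t |-> a + t (b - a). Only polynomials are
   integrated below, so the choice of path from a to b is immaterial. *)
Definition segment_integral (R : realType) (a b : R[i]) (f : R[i] -> R[i]) :
    R[i] :=
  integral01 (fun t : R => f (a + t%:C * (b - a)) * (b - a)).

Definition moment (R : realType) (a b : R[i]) (P Q : {poly R[i]}) (k : nat) :
    R[i] :=
  segment_integral a b (fun z => P.[z] ^+ k * Q.[z] * P^`().[z]).

Definition moment_tilde (R : realType) (a b : R[i]) (P q : {poly R[i]})
    (k : nat) : R[i] :=
  segment_integral a b (fun z => P.[z] ^+ k * q.[z]).

(* None stands for the index being infinite. *)
Definition vanishing_index (R : realType) (m : nat -> R[i]) : option nat :=
  match pselect (exists k, m k != 0) with
  | left ex_k => Some (ex_minn ex_k)
  | right _ => None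
  end.

(* The supremum of N + 1 over the pairs with finite index N is taken among
   0, 1, 2, ..., +oo: adjoining 0 makes the supremum of the empty family 0
   (in \bar R it would be -oo) and changes nothing otherwise. *)
Definition bautin_index (R : realType)
    (mom : {poly R[i]} -> {poly R[i]} -> nat -> R[i]) (d1 d2 : nat) : \bar R :=
  ereal_sup (0%E |` [set x : \bar R | exists (F G : {poly R[i]}) (n : nat),
    [/\ (size F <= d1.+1)%N, (size G <= d2.+1)%N,
        vanishing_index (mom F G) = Some n & x = (n.+1%:R)%:E]]).

(* Pitfall: if a != b and dP = 1, the value is dQ + 1, attained by P = 'X and
   the degree dQ Legendre polynomial Q of the segment from a to b. So a bound
   of the form dQ + c (dP - 1)^2 cannot hold for dP = 1. *)
Definition moment_bautin_index (R : realType) (dP dQ : nat) (a b : R[i]) :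
    \bar R :=
  bautin_index (moment a b) dP dQ.

Definition moment_tilde_bautin_index (R : realType) (dP dq : nat)
    (a b : R[i]) : \bar R :=
  bautin_index (moment_tilde a b) dP dq.

(* Main.v *)
From HB Require Import structures.
Require Import Defs.
From mathcomp Require Import all_boot all_order all_algebra.
From mathcomp Require Import complex.
From mathcomp Require Import all_classical all_reals all_analysis.
From mathcomp Require Import perm zify ring lra.

Import Order.TTheory GRing.Theory Num.Theory.
Import numFieldNormedType.Exports.

Local Open Scope ring_scope.

Set Implicit Arguments.
Unset Strict Implicit.
Unset Printing Implicit Defensive.

(* Write [p] for the derivative of [P], [d] for its degree, [m_k] for the
   moments and [delta] for the derivation [(1/p) d/dz] of [F(z)], which extends
   [d/dt] along [t = P(z)].  The series [H = \sum_k m_k t^(-k-1)] expands the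
   integral of [Q p / (t - P)] at infinity.

   As [F(z)] has dimension [d] over [F(P)], the functions [delta^i Q] satisfy a
   relation [\sum_(i <= r) N_i(P) delta^i Q = 0] with [r <= d] minimal, the
   [N_i] being minors of the matrix of coordinates of the [p^m delta^i Q], with
   [m = 2d - 1]; this bounds their degrees.  Integration by parts shows that
   [\sum_i N_i H^(i)] has no singularities other than poles of order at most [r]
   at [P(a)] and [P(b)].  Hence it vanishes identically as soon as [H] vanishes
   to a high enough order at infinity, and then [delta^i Q |-> H^(i)] defines an
   [F(t)]-linear map [phi] commuting with the derivations.

   By Cramer's rule, deg_t (phi g) < deg_z g / d for all [g] if [H] vanishes to
   a high order.  But applying [t d/dt - c] to [g], with [c = deg_z g / d],
   lowers [deg_z g] without changing [deg_t (phi g)] (which differs from [c]),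
   so that an iteration starting at [g = Q] contradicts this inequality if [H]
   is not 0. *)

(** * Weighted degree bounds *)

(* With [D] the degree of [P], this bounds the degree of [A \Po P] by [w]; a
   negative [w] forces [A = 0]. *)
Definition wdeg (R : nzRingType) (D : nat) (A : {poly R}) (w : int) :=
  forall k, A`_k != 0 -> (D * k)%:Z <= w.

Section WeightedDegree.
Variables (R : comNzRingType) (D : nat).
Implicit Types (A B : {poly R}) (v w : int).

Lemma wdeg_le A v w : wdeg D A v -> v <= w -> wdeg D A w.
Proof. by move=> Av vw k /Av /le_trans; apply. Qed.

Lemma wdeg0 w : wdeg D (0 : {poly R}) w.
Proof. by move=> k; rewrite coef0 eqxx. Qed.

Lemma wdegC c w : 0 <= w -> wdeg D (c%:P : {poly R}) w.
Proof. by move=> w0 [|k]; rewrite coefC ?muln0 ?eqxx. Qed.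

Lemma wdegD A B w : wdeg D A w -> wdeg D B w -> wdeg D (A + B) w.
Proof.
move=> Aw Bw k; rewrite coefD; have [->|/Aw//] := eqVneq A`_k 0.
by rewrite add0r => /Bw.
Qed.

Lemma wdegZ c A w : wdeg D A w -> wdeg D (c *: A) w.
Proof.
move=> Aw k; rewrite coefZ; have [->|/Aw//] := eqVneq A`_k 0.
by rewrite mulr0 eqxx.
Qed.

Lemma wdegN A w : wdeg D A w -> wdeg D (- A) w.
Proof. by rewrite -scaleN1r; apply: wdegZ. Qed.

Lemma wdegM A B v w : wdeg D A v -> wdeg D B w -> wdeg D (A * B) (v + w).
Proof.
move=> Av Bw k; rewrite coefM => nz.
have [i /andP[/Av Ai /Bw Bi]|all0] := pickP (fun i : 'I_k.+1 =>
  (A`_i != 0) && (B`_(k - i) != 0)).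
  by have := lerD Ai Bi; rewrite -PoszD -mulnDr subnKC // -ltnS.
case/eqP: nz; apply: big1 => i _; move: (all0 i) => /negbT.
by rewrite negb_and !negbK => /orP[] /eqP->; rewrite ?mul0r ?mulr0.
Qed.

Lemma wdeg_sum (I : Type) (s : seq I) (p : pred I) (A : I -> {poly R}) w :
  (forall i, p i -> wdeg D (A i) w) -> wdeg D (\sum_(i <- s | p i) A i) w.
Proof.
move=> Aw; apply: (big_ind (fun B => wdeg D B w)) => //; first exact: wdeg0.
by move=> *; apply: wdegD.
Qed.

Lemma wdeg_prod (I : Type) (s : seq I) (p : pred I) (A : I -> {poly R})
    (w : I -> int) :
  (forall i, p i -> wdeg D (A i) (w i)) ->
  wdeg D (\prod_(i <- s | p i) A i) (\sum_(i <- s | p i) w i).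
Proof.
move=> Aw; apply: (big_ind2 (fun B v => wdeg D B v)) => //.
  by rewrite -polyC1; apply: wdegC.
by move=> *; apply: wdegM.
Qed.

(** Row [i] contributes [x i] and column [j] takes off [y j], so all products in the Leibniz
    expansion obey the same bound. *)
Lemma wdeg_det n (M : 'M[{poly R}]_n) (x y : 'I_n -> int) :
  (forall i j, wdeg D (M i j) (x i - y j)) ->
  wdeg D (\det M) (\sum_i x i - \sum_i y i).
Proof.
move=> Mw; apply: wdeg_sum => s _.
have -> : \sum_i x i - \sum_i y i = \sum_i (x i - y (s i)) :> int.
  by rewrite big_split /= -sumrN [X in _ + X](reindex_inj (@perm_inj _ s)).
rewrite -signr_odd; case: odd; rewrite ?expr1 ?expr0 ?mulN1r ?mul1r.
  by apply: wdegN; apply: wdeg_prod.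
by apply: wdeg_prod.
Qed.

Lemma wdeg_deriv A w : wdeg 1 A w -> wdeg 1 A^`() (w - 1).
Proof.
move=> Aw k; rewrite coef_deriv; have [->|/Aw] := eqVneq A`_k.+1 0.
  by rewrite mul0rn eqxx.
lia.
Qed.

Lemma wdeg_size A n : (size A <= n.+1)%N -> wdeg 1 A n.
Proof.
move=> sA k; rewrite mul1n lez_nat -ltnS => nz; apply: leq_trans sA.
by rewrite ltnNge; apply: contra nz => lt; rewrite nth_default.
Qed.

End WeightedDegree.

Lemma wdeg_mul_cancel (R : idomainType) (D : nat) (A B : {poly R}) (w : int) :
  A != 0 -> wdeg D (A * B) w -> wdeg D B (w - (D * (size A).-1)%:Z).
Proof.
move=> A0 ABw k Bk; have B0 : B != 0.
  by apply: contraNneq Bk => ->; rewrite coef0.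
have kB : (k <= (size B).-1)%N.
  rewrite -ltnS prednK ?size_poly_gt0 // ltnNge.
  by apply: contra Bk => lt; rewrite nth_default.
have := ABw (size (A * B)).-1; rewrite -[_`__]lead_coefE lead_coef_eq0.
rewrite mulf_neq0 // => /(_ isT); rewrite size_mul //.
have := size_poly_gt0 A; have := size_poly_gt0 B; rewrite A0 B0.
move: kB; move: (size A) (size B) => [//|u] [//|v] kv _ _.
rewrite addSn addnS /= => le_w; rewrite lerBrDr -PoszD -mulnDr.
by apply: le_trans le_w; rewrite lez_nat leq_mul2l addnC leq_add2l kv orbT.
Qed.

(** * Coordinates over F[P] and minors *)

(* Coordinates of [f] in the basis [1, 'X, 'X^2, ...] of [{poly F}] over its
   subring [F[P]]: [f] is the sum of the [(coordP P j f \Po P) * 'X^j], for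
   [j] less than the degree of [P]. *)
Definition coordP (F : fieldType) (P : {poly F}) (j : nat) (f : {poly F}) :
    {poly F} :=
  \poly_(k < size f) ((f %/ P ^+ k) %% P)`_j.

Section Coordinates.
Variables (F : fieldType) (P : {poly F}) (d : nat).
Hypotheses (sP : size P = d.+1) (d_gt0 : (0 < d)%N).
Implicit Types f g A : {poly F}.

Let P_neq0 : P != 0.
Proof. by rewrite -size_poly_gt0 sP. Qed.

Let sizeX k : size (P ^+ k) = (d * k).+1.
Proof. by rewrite -[LHS]prednK ?size_exp ?sP ?size_poly_gt0 ?expf_neq0. Qed.

Lemma coef_coordP j f k : (coordP P j f)`_k = ((f %/ P ^+ k) %% P)`_j.
Proof.
rewrite coef_poly; case: ltnP => // le_f_k; rewrite divp_small ?mod0p ?coef0 //.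
by rewrite sizeX ltnS (leq_trans le_f_k) // leq_pmull.
Qed.

Lemma coordPD j f g : coordP P j (f + g) = coordP P j f + coordP P j g.
Proof. by apply/polyP => k; rewrite coefD !coef_coordP divpD modpD coefD. Qed.

Lemma coordP0 j : coordP P j 0 = 0.
Proof. by apply/polyP => k; rewrite coef_coordP div0p mod0p !coef0. Qed.

Lemma coordPZ j c f : coordP P j (c *: f) = c *: coordP P j f.
Proof. by apply/polyP => k; rewrite coefZ !coef_coordP divpZl modpZl coefZ. Qed.

Lemma coordP_mulP j f : coordP P j (P * f) = 'X * coordP P j f.
Proof.
apply/polyP => -[|k]; rewrite coefXM coef_coordP.
  by rewrite expr0 divp1 mulrC modp_mull coef0.
by rewrite exprS divp_pmul2l ?expf_neq0 // coef_coordP.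
Qed.

Lemma coordPM j A f : coordP P j ((A \Po P) * f) = A * coordP P j f.
Proof.
elim/poly_ind: A => [|A c IH]; first by rewrite comp_poly0 !mul0r coordP0.
rewrite comp_poly_MXaddC !mulrDl coordPD !mul_polyC coordPZ; congr (_ + _).
have -> : (A \Po P) * P * f = P * ((A \Po P) * f) by rewrite mulrA (mulrC P).
by rewrite coordP_mulP IH mulrCA mulrA.
Qed.

Lemma coordP_sum (I : Type) (s : seq I) (p : pred I) (f : I -> {poly F}) j :
  coordP P j (\sum_(i <- s | p i) f i) = \sum_(i <- s | p i) coordP P j (f i).
Proof. by apply: (big_morph _ (coordPD j) (coordP0 j)). Qed.

(** The constant coefficients of the coordinates are the coefficients of [f %% P]. When they vanish,
    [P] divides [f], and the quotient, of smaller size, again has zero coordinates. *)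
Lemma coordP_inj f : (forall j, (j < d)%N -> coordP P j f = 0) -> f = 0.
Proof.
move: {2}(size f) (leqnn (size f)) => n.
elim: n f => [|n IH] f; first by rewrite leqn0 size_poly_eq0 => /eqP.
move=> le_f_n f0; have mod0 : f %% P = 0.
  apply/polyP => j; rewrite coef0; have [lt_jd|le_dj] := ltnP j d.
    by have /polyP/(_ 0) := f0 j lt_jd; rewrite coef_coordP expr0 divp1 coef0.
  by rewrite nth_default // (leq_trans _ le_dj) // -ltnS -sP ltn_modp.
have Ef : f = P * (f %/ P) by rewrite {1}(divp_eq f P) mod0 addr0 mulrC.
rewrite Ef (IH (f %/ P)) ?mulr0 //.
  rewrite size_divp // sP leq_subLR (leq_trans le_f_n) //.
  by rewrite -addn1 addnC leq_add2r.
move=> j lt_jd; have /eqP := f0 j lt_jd.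
by rewrite {1}Ef coordP_mulP mulf_eq0 polyX_eq0 /= => /eqP.
Qed.

(** A nonzero [k]-th coefficient forces [f %/ P ^+ k] to have degree at least [j], hence [f] to have
    degree at least [d * k + j]. *)
Lemma wdeg_coordP j f w : wdeg 1 f w -> wdeg d (coordP P j f) (w - j%:Z).
Proof.
move=> fw k; rewrite coef_coordP => nz.
have f0 : f != 0 by apply: contraNneq nz => ->; rewrite div0p mod0p coef0.
have : (j < size (f %/ P ^+ k)%R)%N.
  apply: leq_trans (leq_modp _ P).
  by rewrite ltnNge; apply: contra nz => ?; rewrite nth_default.
rewrite size_divp ?expf_neq0 // sizeX /=.
have := fw (size f).-1; rewrite -lead_coefE lead_coef_eq0 => /(_ f0).
move: f0; rewrite -size_poly_gt0; move: (size f) => s. lia.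
Qed.

End Coordinates.

Definition minorP (F : fieldType) (P : {poly F}) (f : nat -> {poly F})
    (n d : nat) (J : 'I_n -> 'I_d) : {poly F} :=
  \det (\matrix_(i < n, j < n) coordP P (J j) (f i)).

Section Minors.
Variables (F : fieldType) (P : {poly F}) (d : nat) (f : nat -> {poly F}).
Hypotheses (sP : size P = d.+1) (d_gt0 : (0 < d)%N).

Lemma minorP_inj n (J : 'I_n -> 'I_d) : minorP P f J != 0 -> injective J.
Proof.
move=> nz i j eqJ; apply/eqP; apply: contraNT nz => nij.
rewrite /minorP -det_tr; apply/eqP; apply: (determinant_alternate nij) => k.
by rewrite !mxE eqJ.
Qed.

(** Here [r.+2] is the least [n] for which all minors on the first [n] functions vanish. It is at
    most [d.+1] by the pigeonhole principle on columns, and at least 2 as [f 0] has a nonzero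
    coordinate. *)
Lemma exists_rank : f 0 != 0 -> exists r, (r < d)%N /\
  exists2 J : 'I_r.+1 -> 'I_d, minorP P f J != 0 &
  forall J' : 'I_r.+2 -> 'I_d, minorP P f J' = 0.
Proof.
move=> f0; pose p n := [forall J : {ffun 'I_n -> 'I_d}, minorP P f J == 0].
have pd : exists n, p n.
  exists d.+1; apply/forallP => J; apply: contraT => /minorP_inj /leq_card.
  by rewrite !card_ord ltnn.
case: (ex_minnP pd) => -[|[|r]] p_n min_n.
- move/forallP/(_ [ffun=> Ordinal d_gt0]): p_n.
  by rewrite /minorP det_mx00 oner_eq0.
- case/eqP: f0; apply: (coordP_inj sP d_gt0) => j lt_jd.
  move/forallP/(_ [ffun=> Ordinal lt_jd]): p_n.
  by rewrite /minorP det_mx11 mxE ffunE => /eqP.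
have : ~~ p r.+1 by apply/negP => /min_n; rewrite ltnn.
rewrite negb_forall => /existsP[J nzJ]; exists r; split.
  by move/minorP_inj/leq_card: nzJ; rewrite !card_ord.
exists J => // J'; move/forallP/(_ (finfun J')): p_n => /eqP <-.
by rewrite /minorP; congr (\det _); apply/matrixP => i j; rewrite !mxE ffunE.
Qed.

(** The coefficients are cofactors: whichever coordinate [c] is appended to [J] as a last column,
    the expansion of the minor along it is 0, and the cofactors do not involve [c]. *)
Lemma syzygy r (J : 'I_r -> 'I_d) (x : nat -> int) :
  (forall J' : 'I_r.+1 -> 'I_d, minorP P f J' = 0) ->
  (forall i, (i <= r)%N -> wdeg 1 (f i) (x i)) ->
  exists N : nat -> {poly F},
  [/\ \sum_(i < r.+1) (N i \Po P) * f i = 0, N r = minorP P f J &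
  forall i, (i <= r)%N ->
    wdeg d (N i) (\sum_(k < r.+1) x k - x i - \sum_j (J j)%:Z)].
Proof.
move=> dep fx.
pose A (i : 'I_r.+1) := \matrix_(k < r, l < r) coordP P (J l) (f (lift i k)).
exists (fun i => (-1) ^+ (i + r) * \det (A (inord i))); split.
- apply: (coordP_inj sP d_gt0) => c lt_cd; rewrite (coordP_sum sP d_gt0).
  pose J' (j : 'I_r.+1) := oapp J (Ordinal lt_cd) (unlift ord_max j).
  rewrite -[RHS](dep J') /minorP (expand_det_col _ ord_max).
  apply: eq_bigr => i _; rewrite (coordPM sP d_gt0) mulrC mxE {1}/J' unlift_none
    /=.
  congr (_ * _); rewrite /cofactor inord_val; congr (_ * \det _).
  by apply/matrixP => k l; rewrite !mxE /J' /= liftK.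
- rewrite addnn -signr_odd odd_double expr0 mul1r /minorP; congr (\det _).
  apply/matrixP => k l; rewrite !mxE; congr (coordP P _ (f _)).
  by rewrite /= inordK // /bump leqNgt ltn_ord.
move=> i le_ir.
have wA : wdeg d (\det (A (inord i))) (\sum_(k < r.+1) x k - x i - \sum_j (J
  j)%:Z).
  have -> : \sum_(k < r.+1) x k - x i = \sum_(k < r) x (lift (inord i : 'I_r.+1)
    k).
    by rewrite (bigD1_ord (inord i)) //= inordK // addrAC subrr add0r.
  apply: wdeg_det => k l; rewrite mxE; apply: (wdeg_coordP sP d_gt0).
  by apply: fx; rewrite -ltnS.
rewrite -signr_odd; case: odd; rewrite ?expr1 ?expr0 ?mulN1r ?mul1r //.
exact: wdegN.
Qed.

(** The row of the [c i] times the matrix of the minor is the row of coordinates of the sum;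
    multiplying by the adjugate isolates [minorP P f J * c i]. *)
Lemma wdeg_cramer r (J : 'I_r.+1 -> 'I_d) (x : nat -> int) (c : nat -> {poly F})
    (w : int) :
  (forall i, (i <= r)%N -> wdeg 1 (f i) (x i)) ->
  wdeg 1 (\sum_(i < r.+1) (c i \Po P) * f i) w ->
  forall i, (i <= r)%N -> wdeg d (minorP P f J * c i)
    (\sum_(k < r.+1) x k - x i + w - \sum_j (J j)%:Z).
Proof.
move=> fx; set g := \sum_(i < _) _ => gw i le_ir.
pose i' : 'I_r.+1 := inord i; have i'E : i' = i :> nat by rewrite inordK.
set M := \matrix_(k < r.+1, l < r.+1) coordP P (J l) (f k).
have cM : \row_k c k *m M = \row_l coordP P (J l) g.
  apply/rowP => l; rewrite !mxE (coordP_sum sP d_gt0); apply: eq_bigr => k _.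
  by rewrite !mxE (coordPM sP d_gt0).
have -> : minorP P f J * c i = \sum_l coordP P (J l) g * cofactor M i' l.
  have /matrixP/(_ 0 i') := congr1 (mulmx^~ (\adj M)) cM.
  rewrite -mulmxA mul_mx_adj mul_mx_scalar !mxE i'E => ->.
  by apply: eq_bigr => l _; rewrite !mxE.
apply: wdeg_sum => l _.
rewrite [X in _ - X](bigD1_ord l) // [X in X - _ + _](bigD1_ord i') // i'E.
set X := \sum_(_ < _) x _; set Y := \sum_(_ < _) _.
have -> : x i + X - x i + w - ((J l)%:Z + Y) = w - (J l)%:Z + (X - Y) by ring.
apply: wdegM.
  exact: (wdeg_coordP sP d_gt0).
have wM : wdeg d (\det (row' i' (col' l M)))
    (\sum_(k < r) x (lift i' k) - \sum_(k < r) (J (lift l k))%:Z).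
  apply: (wdeg_det (x := fun k => x (lift i' k)) (y := fun k => (J (lift l
    k))%:Z)).
  by move=> k m; rewrite !mxE; apply: (wdeg_coordP sP d_gt0); apply: fx;
    rewrite -ltnS.
rewrite /cofactor -signr_odd; case: odd;
  rewrite ?expr1 ?expr0 ?mulN1r ?mul1r //.
  exact: wdegN.
Qed.

(** The values are distinct, so at most one of them is 0. *)
Lemma leq_sum_inj r (J : 'I_r -> 'I_d) : injective J -> (r.-1 <= \sum_j J j)%N.
Proof.
move=> injJ; have [j0 /eqP Jj0|J_neq0] := pickP (fun j => J j == 0%N :> nat).
  have <- : #|predC1 j0| = r.-1 by rewrite cardC1 card_ord.
  rewrite (bigD1 j0) //= Jj0 add0n -sum1_card.
  apply: leq_sum => j; apply: contraTltn; rewrite leqn0 => /eqP Jj.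
  by rewrite inE negbK -(inj_eq injJ) -val_eqE /= Jj Jj0.
rewrite -[leqLHS](card_ord r.-1) -sum1_card;
  case: r J injJ J_neq0 => [|r] J _ J_neq0.
  by rewrite !big_ord0.
rewrite big_ord_recr /= -[leqLHS]addn0 leq_add // leq_sum // => j _.
by rewrite lt0n J_neq0.
Qed.

End Minors.

(** * Formal series in t and 1/t *)

(* A formal series in [t] with coefficients indexed by [int] is a map
   [int -> F]; as no condition is put on its support, these series form a
   module over [F[t]], but not a ring. *)
Definition pact (F : nzRingType) (A : {poly F}) (h : int -> F) : int -> F :=
  fun n => \sum_(j < size A) A`_j * h (n - j%:Z).

Definition fder (F : nzRingType) (h : int -> F) : int -> F :=
  fun n => (n + 1)%:~R * h (n + 1).

Definition fdeg_le (F : nzRingType) (h : int -> F) (w : int) :=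
  forall n, w < n -> h n = 0.

Section FormalSeries.
Variable F : comNzRingType.
Implicit Types (A B : {poly F}) (h g : int -> F) (n w : int).

Lemma pact_widen A h n m : (size A <= m)%N ->
  pact A h n = \sum_(j < m) A`_j * h (n - j%:Z).
Proof.
move=> le_Am; rewrite /pact (big_ord_widen m (fun j => A`_j * h (n - j%:Z))) //.
rewrite big_mkcond; apply: eq_bigr => j _ /=; case: ltnP => // le_Aj.
by rewrite nth_default ?mul0r.
Qed.

Lemma pactD A B h : pact (A + B) h = pact A h + pact B h.
Proof.
apply/funext => n; pose m := maxn (size A) (size B).
rewrite [LHS](@pact_widen _ _ _ m) ?size_polyD // addrfctE.
rewrite !(@pact_widen _ _ _ m) ?leq_maxl ?leq_maxr // -big_split /=.
by apply: eq_bigr => j _; rewrite coefD mulrDl.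
Qed.

Lemma pactZ c A h : pact (c *: A) h = pact c%:P (pact A h).
Proof.
apply/funext => n; rewrite !(@pact_widen (c *: A) _ _ (size A)) ?size_scale_leq
  //.
rewrite (@pact_widen _ _ _ 1) ?size_polyC_leq1 // big_ord1 coefC subr0
  mulr_sumr.
by apply: eq_bigr => j _; rewrite coefZ mulrA.
Qed.

Lemma pactC c h n : pact c%:P h n = c * h n.
Proof. by rewrite (@pact_widen _ _ _ 1) ?size_polyC_leq1 // big_ord1 coefC
  subr0. Qed.

Lemma pact0 h : pact 0 h = 0.
Proof. by apply/funext => n; rewrite -polyC0 pactC mul0r. Qed.

Lemma pact1 h : pact 1 h = h.
Proof. by apply/funext => n; rewrite -polyC1 pactC mul1r. Qed.

Lemma pactMX A h n : pact (A * 'X) h n = pact A h (n - 1).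
Proof.
rewrite (@pact_widen _ _ _ (size A).+1); last first.
  by rewrite (leq_trans (size_polyMleq _ _)) // size_polyX addn2.
rewrite big_ord_recl coefMX mul0r add0r; apply: eq_bigr => j _.
by rewrite coefMX /=; congr (_ * h _); rewrite /bump /= PoszD opprD addrA.
Qed.

Lemma pactDr A h g : pact A (h + g) = pact A h + pact A g.
Proof.
apply/funext => n; rewrite !addrfctE /pact /= -big_split /=.
by apply: eq_bigr => j _; rewrite mulrDr.
Qed.

Lemma pact0r A : pact A 0 = 0.
Proof. by apply/funext => n; rewrite /pact big1 // => j _; rewrite mulr0. Qed.

Lemma pactM A B h : pact (A * B) h = pact A (pact B h).
Proof.
apply/funext => n; elim/poly_ind: A n => [|A c IH] n;
  first by rewrite mul0r !pact0.
rewrite mulrDl !pactD !addrfctE mul_polyC pactZ mulrAC !pactMX IH.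
by rewrite !pactC.
Qed.

Lemma fder_pact A h : fder (pact A h) = pact A^`() h + pact A (fder h).
Proof.
apply/funext => n; rewrite addrfctE.
elim/poly_ind: A n => [|A c IH] n.
  by rewrite deriv0 /fder !pact0 mulr0 addr0.
rewrite derivD derivM derivX derivC mulr1 addr0 /fder !pactD !addrfctE.
rewrite !pactMX !pactC -/(fder h n) addrK.
have := IH (n - 1); rewrite /fder subrK => IHn.
have -> : (n + 1)%:~R * (pact A h n + c * h (n + 1)) =
  n%:~R * pact A h n + pact A h n + c * ((n + 1)%:~R * h (n + 1)).
  by rewrite intrD; ring.
by rewrite IHn -/(fder h); ring.
Qed.

Lemma fder_res h : fder h (-1) = 0.
Proof. by rewrite /fder addNr mul0r. Qed.

(** The coefficient at [-1] is the residue, which is 0 on derivatives; so each derivation moves onto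
    [A] with a change of sign. *)
Lemma res_pact_fder A h i :
  pact A (iter i (@fder F) h) (-1) = (-1) ^+ i * pact A^`(i) h (-1).
Proof.
elim: i A => [|i IH] A; first by rewrite expr0 mul1r.
have : pact A (iter i.+1 (@fder F) h) (-1) = - pact A^`() (iter i (@fder F) h)
  (-1).
  apply/eqP; rewrite -addr_eq0 addrC; apply/eqP.
  by have := fder_res (pact A (iter i (@fder F) h)); rewrite fder_pact addrfctE.
by move=> ->; rewrite IH -derivSn exprS mulN1r mulNr.
Qed.

Lemma pact_coef A h k : pact A h (-1 - k%:Z) = pact ('X^k * A) h (-1).
Proof.
elim: k A => [|k IH] A; first by rewrite mul1r subr0.
by rewrite exprSr -mulrA -IH mulrC pactMX; congr (pact A h _); lia.
Qed.

Lemma fdeg_leD h g w : fdeg_le h w -> fdeg_le g w -> fdeg_le (h + g) w.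
Proof. by move=> hw gw n wn; rewrite addrfctE hw ?gw ?addr0. Qed.

Lemma fdeg_le_der h w : fdeg_le h w -> fdeg_le (fder h) (w - 1).
Proof. by move=> hw n wn; rewrite /fder hw ?mulr0 //; lia. Qed.

Lemma fdeg_le_pact A h (v w : int) : wdeg 1 A v -> fdeg_le h w ->
  fdeg_le (pact A h) (v + w).
Proof.
move=> Av hw n wn; apply: big1 => j _.
have [->|/Av] := eqVneq A`_j 0; rewrite ?mul0r // => jv.
by rewrite hw ?mulr0 //; lia.
Qed.

Lemma pact_top A h w : fdeg_le h w ->
  pact A h ((size A).-1%:Z + w) = lead_coef A * h w.
Proof.
move=> hw; have [->|A0] := eqVneq A 0; first by rewrite pact0 lead_coef0 mul0r.
rewrite /pact; have := size_poly_gt0 A; rewrite A0 lead_coefE.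
case: (size A) => //= m _; rewrite big_ord_recr /= big1 ?add0r => [|j _].
  by congr (_ * h _); ring.
by rewrite hw ?mulr0 //; have := ltn_ord j; lia.
Qed.

Lemma fdeg_le_iter h w i : fdeg_le h w -> fdeg_le (iter i (@fder F) h) (w -
  i%:Z).
Proof.
move=> hw; elim: i => [|i IH]; first by rewrite subr0.
by rewrite iterS; have := fdeg_le_der IH; congr (fdeg_le _ _); lia.
Qed.

Lemma pact_sumr (I : Type) (s : seq I) A (h : I -> int -> F) :
  pact A (\sum_(i <- s) h i) = \sum_(i <- s) pact A (h i).
Proof. by apply: (big_morph _ (pactDr A) (pact0r A)). Qed.

End FormalSeries.

(** The coefficient of [h] at its degree bound reappears in the product, multiplied by
    [lead_coef A]; so the bound can be lowered forever. For a series unbounded above this fails: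
    ['X - 1] kills the sum of all powers of [t]. *)
Lemma pact_eq0 (F : idomainType) (A : {poly F}) (h : int -> F) (w : int) :
  A != 0 -> fdeg_le h w -> pact A h = 0 -> h = 0.
Proof.
move=> A0 hw Ah; apply/funext => n; apply/eqP.
have [wn|nw] := ltP w n; first by rewrite hw.
suff hk k : fdeg_le h (w - k%:Z) by rewrite (hk (`|w - n|%N).+1) //; lia.
elim: k => [|k IH]; first by rewrite subr0.
move=> m wm; have [lt|ge] := ltP (w - k%:Z) m; first exact: IH.
have -> : m = w - k%:Z by lia.
have /eqP := pact_top A IH; rewrite Ah eq_sym mulf_eq0 lead_coef_eq0 (negPf A0).
by move/eqP.
Qed.

(** * Integrals of polynomials and rational derivations *)

Definition primitive (F : numFieldType) (f : {poly F}) : {poly F} :=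
  \poly_(i < (size f).+1) (f`_i.-1 / i%:R).

Definition pint (F : numFieldType) (a b : F) (f : {poly F}) : F :=
  (primitive f).[b] - (primitive f).[a].

Lemma deriv_primitive (F : numFieldType) (f : {poly F}) : (primitive f)^`() = f.
Proof.
apply/polyP => i; rewrite coef_deriv coef_poly ltnS; case: ltnP => [_|le_f].
  by rewrite -[LHS]mulr_natr divfK // pnatr_eq0.
by rewrite mul0rn nth_default.
Qed.

Lemma deriv_eq0 (F : numFieldType) (f : {poly F}) : f^`() = 0 -> f = (f`_0)%:P.
Proof.
move=> f'0; apply/polyP => -[|i]; rewrite coefC //=; apply/eqP.
have /polyP/(_ i)/eqP := f'0.
by rewrite coef_deriv coef0 -mulr_natr mulf_eq0 pnatr_eq0 orbF.
Qed.

Lemma pint_deriv (F : numFieldType) (a b : F) (W : {poly F}) :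
  pint a b W^`() = W.[b] - W.[a].
Proof.
have : (primitive W^`() - W)^`() = 0 by rewrite derivB deriv_primitive subrr.
move/deriv_eq0; set c := _`_0 => /(canRL (subrK W)) EW.
by rewrite /pint EW !hornerE; ring.
Qed.

Lemma pint_is_scalar (F : numFieldType) (a b : F) : scalar (pint a b).
Proof.
move=> c f g; rewrite -{1}[f]deriv_primitive -{1}[g]deriv_primitive.
rewrite -derivZ -derivD pint_deriv !hornerD !hornerZ.
by rewrite opprD addrACA -mulrBr.
Qed.

HB.instance Definition _ (F : numFieldType) (a b : F) :=
  GRing.isLinear.Build F {poly F} F *%R (pint a b) (pint_is_scalar a b).

Lemma coefM_top (R : nzRingType) (A B : {poly R}) (u v : nat) :
  (size A <= u.+1)%N -> (size B <= v.+1)%N -> (A * B)`_(u + v) = A`_u * B`_v.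
Proof.
move=> Au Bv; rewrite coefM.
have lt_u : (u < (u + v).+1)%N by rewrite ltnS leq_addr.
rewrite (bigD1 (Ordinal lt_u)) //= addKn big1 ?addr0 // => i.
rewrite -val_eqE /= neq_ltn => /orP[lt|gt].
  by rewrite (nth_default _ (s := B)) ?mulr0 // (leq_trans Bv) //; lia.
by rewrite nth_default ?mul0r // (leq_trans Au).
Qed.

Section RationalDerivation.
Variables (F : numFieldType) (p : {poly F}) (m : nat).
Hypothesis p_neq0 : p != 0.
Implicit Types Y V : {poly F}.

(* The derivative of [Y / p ^+ m] is [logder Y / p ^+ m.+1]. *)
Definition logder Y := Y^`() * p - (Y * p^`()) *+ m.

Lemma logderD Y V : logder (Y + V) = logder Y + logder V.
Proof. by rewrite /logder derivD !mulrDl mulrnDl; ring. Qed.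

Lemma logderN Y : logder (- Y) = - logder Y.
Proof. by rewrite /logder derivN !mulNr mulNrn; ring. Qed.

Lemma logder0 : logder 0 = 0.
Proof. by rewrite /logder deriv0 !mul0r mul0rn subrr. Qed.

Lemma logderM Y V : logder (V * Y) = V^`() * p * Y + V * logder Y.
Proof. by rewrite /logder derivM; ring. Qed.

Lemma logder_exp : logder (p ^+ m) = 0.
Proof.
rewrite /logder deriv_exp; case: m => [|k];
  first by rewrite !mulr0n mul0r subrr.
by rewrite /= exprS; ring.
Qed.

(** Leading coefficients in [logder Z = 0] force a nonzero [Z] to have [m] times the degree of [p].
    Subtracting from [Y] the multiple of [p ^+ m] that clears this coefficient therefore leaves
    0. *)
Lemma logder_eq0 Y : logder Y = 0 -> exists c, Y = c *: p ^+ m.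
Proof.
pose q := (size p).-1; have sp : size p = q.+1 by rewrite prednK ?size_poly_gt0.
have top : (p ^+ m)`_(m * q) = lead_coef p ^+ m.
  by rewrite -lead_coef_exp lead_coefE size_exp mulnC.
have lp : lead_coef p ^+ m != 0 by rewrite expf_neq0 ?lead_coef_eq0.
move=> Y0; exists (Y`_(m * q) / lead_coef p ^+ m); apply/eqP.
rewrite -subr_eq0; set Z := Y - _.
have Z0 : logder Z = 0.
  rewrite /Z -scaleNr -mul_polyC logderD Y0 logderM logder_exp derivC.
  by rewrite !mul0r mulr0 !addr0.
have Zq : Z`_(m * q) = 0 by rewrite coefB coefZ top divfK // subrr.
apply: contraT => nzZ; pose y := (size Z).-1.
have sZ : size Z = y.+1 by rewrite prednK ?size_poly_gt0.
(* The factor ['X] restores the degree lost by differentiation, so that degree 0 needs no separate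
   treatment below. *)
have Xder (A : {poly F}) u : size A = u.+1 -> (size ('X * A^`())%R <= u.+1)%N /\
    ('X * A^`())`_u = A`_u *+ u.
  move=> sA; split.
    apply/leq_sizeP => -[|j] lt_uj //; rewrite coefXM /= coef_deriv.
    by rewrite nth_default ?mul0rn // sA.
  by case: u sA => [|u] sA; rewrite coefXM //= coef_deriv.
have [sZ' cZ'] := Xder _ _ sZ; have [sp' cp'] := Xder _ _ sp.
have : ('X * logder Z)`_(y + q) = 0 by rewrite Z0 mulr0 coef0.
have -> : 'X * logder Z = 'X * Z^`() * p - (Z * ('X * p^`())) *+ m.
  by rewrite /logder; ring.
rewrite coefB coefMn !coefM_top ?sZ ?sp // cZ' cp'.
have lc (A : {poly F}) u : size A = u.+1 -> A`_u = lead_coef A.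
  by rewrite lead_coefE => ->.
rewrite (lc _ _ sp) (lc _ _ sZ) => /eqP.
rewrite mulrnAl mulrnAr -mulrnA subr_eq0 -[X in X == _]mulr_natr -[X in _ ==
  X]mulr_natr.
rewrite (inj_eq (mulfI _)) ?mulf_neq0 ?lead_coef_eq0 // eqr_nat => /eqP Ey.
by move: Zq; rewrite (mulnC m) -Ey (lc _ _ sZ) => /eqP;
  rewrite lead_coef_eq0 (negPf nzZ).
Qed.

End RationalDerivation.

(** * Exactness of the adjoint integrand *)

Section Divisibility.
Variable F : numFieldType.
Implicit Types (A f g : {poly F}) (c : F).

Lemma dvdp_exp_derivn c A r j : ('X - c%:P) ^+ (j + r) %| A ->
  ('X - c%:P) ^+ r %| A^`(j).
Proof.
elim: j A => [//|j IH] A; rewrite derivSn => dvA; apply: IH.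
have /dvdpP[B ->] := dvA; rewrite derivM deriv_exp derivXsubC mul1r /= addSn
  exprS.
apply: dvdp_add; first by rewrite mulrA dvdp_mull.
by rewrite mulrnAr -mulr_natl !dvdp_mull.
Qed.

Lemma dvdp_exp_Xderiv c f n : ('X - c%:P) ^+ n %| f ->
  ('X - c%:P) ^+ n %| ('X - c%:P) * f^`().
Proof.
move=> /dvdpP[g ->]; rewrite derivM deriv_exp derivXsubC mul1r mulrDr.
apply: dvdp_add; first by rewrite mulrA dvdp_mull.
case: n => [|n]; first by rewrite expr0 dvd1p.
by rewrite /= mulrnAr mulrnAr -mulr_natl dvdp_mull // mulrCA -exprS dvdp_mull.
Qed.

End Divisibility.

Section Exactness.
Variables (F : numFieldType) (P Q : {poly F}) (d m : nat) (f : nat -> {poly F}).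
Hypotheses (sP : size P = d.+1) (d_gt0 : (0 < d)%N).
Hypothesis f0 : f 0 = P^`() ^+ m * Q.
Hypothesis fS : forall i, (i < d)%N -> P^`() ^+ 2 * f i.+1 = logder P^`() m (f
  i).

(* Over the denominator [P^`() ^+ m], this is the boundary term obtained when
   [n] integrations by parts move [(d/dP)^n] from [Q] to [A \Po P]. *)
Fixpoint concomitant (A : {poly F}) (n : nat) : {poly F} :=
  if n is n'.+1 then (A \Po P) * f n' - concomitant A^`() n' else 0.

(** Lagrange's identity: the derivative of the alternating sum telescopes to its two extreme
    terms. *)
Lemma logder_concomitant A n : (n <= d)%N ->
  logder P^`() m (concomitant A n) =
  P^`() ^+ 2 * ((A \Po P) * f n - (-1) ^+ n *: ((A^`(n) \Po P) * f 0)).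
Proof.
elim: n A => [|n IH] A le_nd /=.
  by rewrite logder0 expr0 scale1r subrr mulr0.
rewrite logderD logderN IH 1?ltnW // logderM -fS // deriv_comp -derivSn.
by rewrite [(-1) ^+ n.+1]exprS mulN1r scaleNr; ring.
Qed.

Lemma P'_neq0 : P^`() != 0.
Proof.
apply/eqP => /deriv_eq0 EP; move: sP; rewrite EP => sP'.
by have := size_polyC_leq1 P`_0; rewrite sP'; case: (d) d_gt0.
Qed.

Section Endpoint.
Variable z : F.

Lemma critical_order : exists mu u v,
  [/\ P - P.[z]%:P = v * ('X - z%:P) ^+ mu.+1,
      P^`() = u * ('X - z%:P) ^+ mu & ~~ root u z].
Proof.
have [n [v vz E]] := multiplicity_XsubC (P - P.[z]%:P) z.
have nz : P - P.[z]%:P != 0.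
  apply: contraTneq (d_gt0) => /eqP; rewrite subr_eq0 => /eqP EP.
  have := size_polyC_leq1 P.[z]; rewrite -EP sP; lia.
rewrite nz /= in vz.
case: n E => [|mu] E.
  case/negP: vz; rewrite /root; move/(congr1 (horner^~ z)): E.
  by rewrite expr0 mulr1 !hornerE subrr => <-.
exists mu, (v^`() * ('X - z%:P) + v *+ mu.+1), v; split=> //.
  rewrite -[P^`()](subr0) -(derivC P.[z]) -derivB E derivM deriv_exp derivXsubC
    mul1r /=.
  by rewrite exprS; ring.
rewrite /root !hornerE hornerMn subrr mulr0 add0r -mulr_natr mulf_eq0 pnatr_eq0.
by rewrite orbF.
Qed.

Variables (mu : nat) (u v : {poly F}).
Hypothesis Pz : P - P.[z]%:P = v * ('X - z%:P) ^+ mu.+1.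
Hypothesis P'z : P^`() = u * ('X - z%:P) ^+ mu.
Hypothesis uz : ~~ root u z.
Let x := 'X - z%:P.

Let coprime_xu n k : coprimep (x ^+ n) (u ^+ k).
Proof. by rewrite coprimep_expl ?coprimep_expr // coprimep_sym coprimep_XsubC.
  Qed.

Let x_neq0 n : x ^+ n != 0.
Proof. by rewrite expf_neq0 ?polyXsubC_eq0. Qed.

(** Each [delta] raises the order of a pole at [z] by at most [mu.+1]: 1 for differentiating and
    [mu] for dividing by the derivative of [P]. *)
Lemma dvdp_pole s : (s <= d)%N -> x ^+ (m * mu) %| x ^+ (s * mu.+1) * f s.
Proof.
elim: s => [|s IH] le_sd.
  by rewrite mul0n expr0 mul1r f0 P'z exprMn -exprM mulnC -mulrA dvdp_mull //
    dvdp_mulr.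
set j := (s * mu.+1)%N; set g := x ^+ j * f s.
have dv_g : x ^+ (m * mu) %| g by apply: IH; apply: ltnW.
have E : x ^+ j.+1 * P^`() ^+ 2 * f s.+1 =
    x * g^`() * P^`() - (g * (x * P^`()^`())) *+ m - (g * P^`()) *+ j.
  rewrite -mulrA fS // /logder /g derivM deriv_exp derivXsubC mul1r.
  case: (j) => [|k]; rewrite ?exprS; ring.
have dvdP' : x ^+ mu %| P^`() by rewrite P'z dvdp_mull.
have : x ^+ mu * x ^+ (m * mu) %| x ^+ mu * (u ^+ 2 * (x ^+ (s.+1 * mu.+1) * f
  s.+1)).
  have -> : x ^+ mu * (u ^+ 2 * (x ^+ (s.+1 * mu.+1) * f s.+1)) =
      x ^+ j.+1 * P^`() ^+ 2 * f s.+1.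
    by rewrite P'z -/x mulSn -/j exprD !exprS; ring.
  rewrite E !dvdp_sub //.
  - by rewrite [x ^+ _ * _]mulrC dvdp_mul // dvdp_exp_Xderiv.
  - by rewrite -mulr_natl dvdp_mull // [x ^+ _ * _]mulrC dvdp_mul //
    dvdp_exp_Xderiv.
  - by rewrite -mulr_natl dvdp_mull // [x ^+ _ * _]mulrC dvdp_mul.
by rewrite dvdp_mul2l // Gauss_dvdpr.
Qed.

(** At [z], [A \Po P] vanishes to order at least [n * mu.+1], whereas [delta^(n-1) Q] has a pole of
    order at most [(n - 1) * mu.+1]; a zero remains. *)
Lemma dvdp_concomitant A n : (n <= d.+1)%N -> ('X - P.[z]%:P) ^+ n %| A ->
  x ^+ (m * mu).+1 %| concomitant A n.
Proof.
elim: n A => [|n IH] A le_nd dvA /=; first exact: dvdp0.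
apply: dvdp_sub; last by apply: IH;
  [apply: ltnW | apply: (dvdp_exp_derivn (j := 1))].
have /dvdpP[B ->] := dvA; rewrite comp_polyM rmorphXn /= comp_polyB comp_polyX
  comp_polyC Pz -/x.
have -> : (B \Po P) * (v * x ^+ mu.+1) ^+ n.+1 * f n =
    ((B \Po P) * v ^+ n.+1 * x ^+ mu) * (x * (x ^+ (n * mu.+1) * f n)).
  by rewrite exprMn -exprM mulnC mulSn exprD !exprS; ring.
rewrite dvdp_mull // exprS dvdp_mul //.
exact: dvdp_pole.
Qed.

Lemma root_endpoint Y V : Y = P^`() ^+ m * V -> x ^+ (m * mu).+1 %| Y -> V.[z] =
  0.
Proof.
move=> ->; rewrite P'z exprMn -exprM mulnC exprSr (mulrC (u ^+ m)) -mulrA -/x.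
rewrite dvdp_mul2l // Gauss_dvdpr; first by rewrite dvdp_XsubCl => /eqP.
by have := coprime_xu 1 m; rewrite expr1.
Qed.

End Endpoint.

Lemma endpoint_vanish (z : F) r (A : nat -> {poly F}) V :
  (r <= d)%N -> (forall i, (i <= r)%N -> ('X - P.[z]%:P) ^+ r %| A i) ->
  \sum_(i < r.+1) concomitant (A i) i = P^`() ^+ m * V -> V.[z] = 0.
Proof.
move=> le_rd dvA EV; have [mu [u [v [Pz P'z uz]]]] := critical_order z.
apply: (root_endpoint P'z uz EV); rewrite big_seq;
  apply: (big_ind (fun Y => _ %| Y)).
- exact: dvdp0.
- by move=> *; apply: dvdp_add.
move=> i _; have le_ir : (i <= r)%N by rewrite -ltnS.
apply: (dvdp_concomitant Pz P'z uz); first by rewrite leqW // (leq_trans le_ir).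
by apply: dvdp_trans (dvA i le_ir); rewrite dvdp_exp2l.
Qed.

(** Divided by the [m]-th power of the derivative of [P], the sum [Y] of the concomitants is, up to
    sign and a constant, a primitive of the integrand; the factor [B] makes it vanish at both
    endpoints. *)
Lemma pint_adjoint (a b : F) r (N : nat -> {poly F}) (B : {poly F}) :
  (r <= d)%N -> \sum_(i < r.+1) (N i \Po P) * f i = 0 ->
  ('X - P.[a]%:P) ^+ r %| B -> ('X - P.[b]%:P) ^+ r %| B ->
  pint a b ((\sum_(i < r.+1) (-1) ^+ i *: (((B * N i)^`(i)) \Po P)) * Q * P^`())
    = 0.
Proof.
move=> le_rd N0 Ba Bb; set S := \sum_(i < _) _ *: _.
pose Y := \sum_(i < r.+1) concomitant (B * N i) i.
have DY : logder P^`() m Y = - (P^`() ^+ 2 * (S * f 0)).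
  rewrite /Y (big_morph _ (logderD _ _) (logder0 _ _)).
  rewrite (eq_bigr (fun i : 'I_r.+1 => P^`() ^+ 2 * ((B \Po P) * ((N i \Po P) *
    f i)) -
     P^`() ^+ 2 * ((-1) ^+ i *: ((B * N i)^`(i) \Po P) * f 0))).
    rewrite sumrB -!mulr_sumr -mulr_suml N0 !mulr0 sub0r //.
  move=> i _; rewrite logder_concomitant; last by apply: leq_trans le_rd;
    rewrite -ltnS.
  by rewrite comp_polyM mulrBr scalerAl mulrA.
set I := S * Q * P^`().
have [c Ec] : exists c, Y + P^`() ^+ m * primitive I = c *: P^`() ^+ m.
  apply: (logder_eq0 P'_neq0); rewrite logderD DY [_ ^+ m * _]mulrC logderM
    logder_exp mulr0 addr0.
  by rewrite deriv_primitive f0 /I; ring.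
have EV : Y = P^`() ^+ m * (c%:P - primitive I).
  by rewrite mulrBr [_ * c%:P]mulrC mul_polyC -Ec addrK.
have V0 z : ('X - P.[z]%:P) ^+ r %| B -> (primitive I).[z] = c.
  move=> Bz; have := endpoint_vanish (z := z) (A := fun i => B * N i) le_rd _
    EV.
  rewrite hornerD hornerN hornerC => H; apply/esym/eqP; rewrite -subr_eq0 H //.
  by move=> i _; rewrite dvdp_mulr.
by rewrite /pint !V0 // subrr.
Qed.

End Exactness.

(** * The bound on the vanishing index *)

Lemma wdeg_floor (R : nzRingType) (D : nat) (A : {poly R}) (w v : int) :
  wdeg D A w -> w < D%:Z * (v + 1) -> wdeg 1 A v.
Proof.
move=> Aw lt_w k /Aw; rewrite mul1n => le_w; have := le_lt_trans le_w lt_w.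
by rewrite PoszM; nia.
Qed.

Lemma wdeg_coef0 (R : nzRingType) (A : {poly R}) (w : int) :
  wdeg 1 A w -> (forall k : nat, k = w :> int -> A`_k = 0) -> wdeg 1 A (w - 1).
Proof.
move=> Aw A0 k nz; have := Aw k nz; rewrite mul1n le_eqVlt => /orP[/eqP|];
  last by lia.
by move/A0 => E; rewrite E eqxx in nz.
Qed.

Lemma wdeg_coef_gt (R : nzRingType) (A : {poly R}) (w : int) (k : nat) :
  wdeg 1 A w -> w < k -> A`_k = 0.
Proof. by move=> Aw lt_wk; apply/eqP; apply: contraTT lt_wk => /Aw;
  rewrite mul1n -leNgt. Qed.

Section Numerics.
Variables (d e r s N : int).
Hypotheses (r1 : 1 <= r) (rd : r <= d) (e0 : 0 <= e) (rs : r - 1 <= s).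
Hypothesis Ne : e + 2 <= N.
Hypothesis Nd : e + 3 * (d - 1) ^+ 2 + 1 <= N.

(** Here [r] is the order of the operator, [s] the sum of the column indices and [N] one more than
    the index of the first nonzero moment. The factor 2 clears the triangular number in the sum of
    the degrees. *)
Lemma numeric_operator :
  2 * (r * (e + (2 * d - 1) * (d - 1))) - d * (r * (r + 1)) - 2 * s
    < 2 * (d * (N - 2 * r)).
Proof.
have re : 0 <= (d - r) * e by apply: mulr_ge0; lia.
have [d1|d2] : d = 1 \/ 2 <= d by lia.
  by have -> : r = 1; [lia | rewrite d1; lia].
(* [re] and [dr] reduce to [r = d]; there, with [s] and [N] least, the two sides differ by the
   product in [dd]. *)
have dr : 0 <= (d - r) * (d * (3 * d - 3 - r)) by do 2?[apply: mulr_ge0]; lia.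
have dN : d * (e + 3 * (d - 1) ^+ 2 + 1) <= d * N by apply: ler_wpM2l => //;
  lia.
have dd : 0 < (d - 1) * (3 * d * (d - 2) + 2).
  by apply: mulr_gt0; last apply: ltr_wpDl => //; [lia | do 2?[apply: mulr_ge0];
    lia].
nia.
Qed.

Lemma numeric_cramer :
  2 * ((r - 1) * (e + (2 * d - 1) * (d - 1))) + 2 * ((2 * d - 1) * (d - 1))
    - d * (r * (r - 1)) - 2 * s < 2 * (d * N).
Proof.
have := numeric_operator; have : 0 <= (d - 1) * r by apply: mulr_ge0; lia. nia.
Qed.

End Numerics.

(* [delta^i Q] is [deriv_numerator p Q i / p ^+ (2 * i).-1]; the case [i = 1]
   apart saves one power of [p], without which the final bound would fail for
   [d = 2]. *)
Fixpoint deriv_numerator (F : numFieldType) (p Q : {poly F}) (i : nat) :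
    {poly F} :=
  match i with
  | 0 => Q
  | 1 => Q^`()
  | i'.+1 => logder p (2 * i').-1 (deriv_numerator p Q i')
  end.

Lemma exists_deriv_tower (F : numFieldType) (p Q : {poly F}) (d : nat) :
  exists2 f : nat -> {poly F}, f 0 = p ^+ (2 * d).-1 * Q &
  forall i, (i < d)%N -> p ^+ 2 * f i.+1 = logder p (2 * d).-1 (f i).
Proof.
exists (fun i => p ^+ ((2 * d).-1 - (2 * i).-1) * deriv_numerator p Q i).
  by rewrite subn0.
(* The exponent [(2 * i).-1] grows by 1 in the first step and by 2 in the later ones. *)
move=> [|i] lt_id; rewrite logderM /logder deriv_exp.
  have -> : ((2 * d).-1 - (2 * 1).-1 = (2 * d).-2)%N by lia.
  have -> : ((2 * d).-1 - (2 * 0).-1 = (2 * d).-2.+1)%N by lia.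
  have -> : ((2 * d).-1 = (2 * d).-2.+1)%N by lia.
  by rewrite /= !exprS; ring.
have [k ->] : exists k, d = (i + k).+2 by exists (d - i.+2)%N; lia.
have -> : ((2 * (i + k).+2).-1 - (2 * i.+2).-1 = 2 * k)%N by lia.
have -> : ((2 * (i + k).+2).-1 - (2 * i.+1).-1 = (2 * k).+2)%N by lia.
have -> : ((2 * (i + k).+2).-1 = (2 * k).+2 + (2 * i.+1).-1)%N by lia.
have -> : deriv_numerator p Q i.+2 =
  logder p (2 * i.+1).-1 (deriv_numerator p Q i.+1) by [].
rewrite /logder.
move: (deriv_numerator p Q i.+1) (2 * i.+1).-1 (2 * k)%N => G j l.
by rewrite succnK !exprS; ring.
Qed.

Lemma size_deriv_num (F : numFieldType) (P : {poly F}) d :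
  size P = d.+1 -> (0 < d)%N -> size P^`() = d.
Proof.
move=> sP d_gt0; apply/eqP; rewrite eqn_leq -ltnS -sP lt_size_deriv
  -?size_poly_gt0 ?sP //=.
rewrite leqNgt; apply/negP => lt.
have /eqP : P^`()`_d.-1 = 0 by rewrite nth_default // -ltnS prednK.
rewrite coef_deriv prednK // -mulr_natr mulf_eq0 pnatr_eq0 (gtn_eqF d_gt0) orbF.
by have := lead_coef_eq0 P; rewrite lead_coefE sP /= => ->;
  rewrite -size_poly_eq0 sP.
Qed.

(** * Derivation on a module with a linear relation *)

Section ModuleAction.
Variables (F : comNzRingType) (V : zmodType) (act : {poly F} -> V -> V).
Hypothesis actD : forall A B v, act (A + B) v = act A v + act B v.
Hypothesis actDr : forall A v w, act A (v + w) = act A v + act A w.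
Hypothesis actM : forall A B v, act (A * B) v = act A (act B v).
Variables (r : nat) (N : nat -> {poly F}) (v : nat -> V).
Hypothesis Nv : \sum_(i < r.+2) act (N i) (v i) = 0.

(* If [v i.+1] is the derivative of [v i], the operator [\sum_i N_i d^i] kills
   [v 0], so that [nabla] gives the coefficients of the derivative of
   [\sum_i b_i v_i], multiplied by the leading coefficient [N r.+1]. *)
Definition nabla (b : nat -> {poly F}) (i : nat) : {poly F} :=
  N r.+1 * (b i)^`() + (if i is j.+1 then N r.+1 * b j else 0) - b r * N i.

Lemma act0r A : act A 0 = 0.
Proof. by apply: (addrI (act A 0)); rewrite -actDr !addr0. Qed.

Lemma act0 w : act 0 w = 0.
Proof. by apply: (addrI (act 0 w)); rewrite -actD !addr0. Qed.

Lemma actN A w : act (- A) w = - act A w.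
Proof. by apply: (addrI (act A w)); rewrite -actD !subrr act0. Qed.

Lemma act_sum (I : Type) (s : seq I) A (w : I -> V) :
  act A (\sum_(i <- s) w i) = \sum_(i <- s) act A (w i).
Proof. by apply: (big_morph _ (actDr A) (act0r A)). Qed.

(** The relation [Nv] trades the term in [v r.+1] for lower ones. The module is abstract because it
    will be both [{poly F}], acted on through [\Po P], and the formal series. *)
Lemma act_nabla b : \sum_(i < r.+1) act (nabla b i) (v i) =
  act (N r.+1) (\sum_(i < r.+1) (act (b i)^`() (v i) + act (b i) (v i.+1))).
Proof.
rewrite act_sum (eq_bigr (fun i : 'I_r.+1 => act (N r.+1 * (b i)^`()) (v i) +
  act (if i : nat is j.+1 then N r.+1 * b j else 0) (v i) - act (b r) (act (N i)
    (v i)))); last first.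
  by move=> i _; rewrite /nabla !actD actN -actM.
rewrite sumrB -act_sum; have := Nv; rewrite big_ord_recr /= => /eqP.
rewrite addr_eq0 => /eqP ->; rewrite -actN -(actN (N r.+1)) -actM mulrNN.
rewrite big_split [X in _ + X + _]big_ord_recl /= act0 add0r.
under [RHS]eq_bigr do rewrite actDr -!actM.
rewrite big_split /= -addrA; congr (_ + _).
by rewrite [RHS]big_ord_recr /= mulrC.
Qed.

End ModuleAction.

(** * Contradiction from a late first nonzero moment *)

Section Core.
Variables (F : numFieldType) (a b : F) (P Q : {poly F}) (d e : nat).
Hypotheses (sP : size P = d.+1) (d_gt0 : (0 < d)%N) (sQ : (size Q <= e.+1)%N).
Let m := (2 * d).-1.
Let p := P^`().
Variable f : nat -> {poly F}.
Hypothesis f0 : f 0 = p ^+ m * Q.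
Hypothesis fS : forall i, (i < d)%N -> p ^+ 2 * f i.+1 = logder p m (f i).

Let sp : size p = d. Proof. exact: size_deriv_num. Qed.
Let p_neq0 : p != 0. Proof. by rewrite -size_poly_gt0 sp. Qed.

Let wdegp : wdeg 1 p (d%:Z - 1).
Proof. by apply: wdeg_le (wdeg_size (n := d.-1) _) _; rewrite ?sp ?prednK //;
  lia. Qed.

Let wdegP : wdeg 1 P d. Proof. by apply: wdeg_size; rewrite sP. Qed.

Let wdegpX k : wdeg 1 (p ^+ k) (k%:Z * (d%:Z - 1)).
Proof.
elim: k => [|k IH]; first by rewrite mul0r expr0 -polyC1; apply: wdegC.
by rewrite exprS; apply: wdeg_le (wdegM wdegp IH) _; lia.
Qed.

Let size_p2 : (size (p ^+ 2)).-1 = (2 * d.-1)%N.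
Proof. by rewrite size_exp sp mulnC. Qed.

Definition tower_deg (i : nat) : int := e%:Z + m%:Z * (d%:Z - 1) - d%:Z * i%:Z.

Lemma wdeg_logder G w : wdeg 1 G w -> wdeg 1 (logder p m G) (w + d%:Z - 2).
Proof.
move=> Gw; apply: wdegD.
  by apply: wdeg_le (wdegM (wdeg_deriv Gw) wdegp) _; lia.
apply: wdegN; rewrite -mulr_natl -polyC_natr mul_polyC; apply: wdegZ.
by apply: wdeg_le (wdegM Gw (wdeg_deriv wdegp)) _; lia.
Qed.

(** [logder] adds at most [d - 2] to the degree and cancelling [p ^+ 2] takes off [2 * (d - 1)], so
    each step loses [d]. *)
Lemma wdeg_tower i : (i <= d)%N -> wdeg 1 (f i) (tower_deg i).
Proof.
elim: i => [_|i IH lt_id].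
  rewrite f0 /tower_deg mulr0 subr0 addrC; apply: wdegM; first exact: wdegpX.
  exact: wdeg_size.
have := wdeg_logder (IH (ltnW lt_id)); rewrite -fS //.
move/wdeg_mul_cancel => /(_ (expf_neq0 _ p_neq0)); rewrite size_p2.
by move=> H; apply: wdeg_le H _; rewrite /tower_deg; lia.
Qed.

Lemma sum_tower_deg n : 2 * \sum_(k < n.+1) tower_deg k =
  2 * (n.+1%:Z * (e%:Z + m%:Z * (d%:Z - 1))) - d%:Z * (n%:Z * n.+1%:Z) :> int.
Proof.
elim: n => [|n IH].
  by rewrite big_ord_recl big_ord0 /tower_deg /=; ring.
by rewrite big_ord_recr mulrDr IH /= /tower_deg !intS; ring.
Qed.

Definition mom k := pint a b (P ^+ k * Q * p).

(* The expansion at infinity of the integral of [Q p / (t - P)]; [Negz k] is the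
   exponent [- k - 1]. *)
Definition genseries (n : int) : F := if n is Negz k then mom k else 0.

Lemma res_genseries A : pact A genseries (-1) = pint a b ((A \Po P) * Q * p).
Proof.
rewrite comp_polyE !mulr_suml raddf_sum /=; apply: eq_bigr => j _.
rewrite -!scalerAl linearZ /=; congr (_ * _).
by have -> : -1 - j%:Z = Negz j by lia.
Qed.

Variables (r : nat) (J : 'I_r.+1 -> 'I_d) (N : nat -> {poly F}).
Hypothesis lt_rd : (r < d)%N.
Hypothesis Delta_neq0 : minorP P f J != 0.
Hypothesis Nf : \sum_(i < r.+2) (N i \Po P) * f i = 0.
Hypothesis N_top : N r.+1 = minorP P f J.
Hypothesis Nw : forall i, (i <= r.+1)%N ->
  wdeg d (N i) (\sum_(k < r.+2) tower_deg k - tower_deg i - \sum_j (J j)%:Z).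
Variable n0 : nat.
Hypothesis mom0 : forall k, (k < n0)%N -> mom k = 0.
Hypothesis mom_n0 : mom n0 != 0.
Hypothesis n0_e : (e < n0)%N.
Hypothesis n0_d : (e + 3 * d.-1 ^ 2 <= n0)%N.

Let H i := iter i (@fder F) genseries.

Let sumJ : (r <= \sum_j J j)%N.
Proof. exact: leq_sum_inj (minorP_inj Delta_neq0). Qed.

Let sumJE : \sum_j (J j)%:Z = (\sum_j J j)%N.
Proof. by rewrite (big_morph Posz PoszD (erefl _)). Qed.

Let mE : m%:Z = 2 * d%:Z - 1. Proof. by rewrite /m; lia. Qed.
Let sumJZ : r.+1%:Z - 1 <= (\sum_j J j)%N. Proof. by lia. Qed.
Let n0_eZ : e%:Z + 2 <= n0.+1%:Z. Proof. by lia. Qed.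
Let n0_dZ : e%:Z + 3 * (d%:Z - 1) ^+ 2 + 1 <= n0.+1%:Z.
Proof.
have -> : d%:Z - 1 = d.-1%:Z by lia.
by move: n0_d; rewrite expr2 expnS expn1; lia.
Qed.

Lemma fdeg_genseries : fdeg_le genseries (- n0%:Z - 1).
Proof. by case=> // k lt_k; apply: mom0; lia. Qed.

Lemma fdeg_H i : fdeg_le (H i) (- n0%:Z - 1 - i%:Z).
Proof. exact: fdeg_le_iter fdeg_genseries. Qed.

Let endpoints := ('X - P.[a]%:P) ^+ r.+1 * ('X - P.[b]%:P) ^+ r.+1.

Let wdeg_endpoints : wdeg 1 endpoints (2 * r.+1%:Z).
Proof.
apply: wdeg_le (wdeg_size (n := 2 * r.+1) _) _; rewrite ?PoszM //.
by rewrite size_Mmonic ?monic_neq0 ?monic_exp ?monicXsubC // !size_exp_XsubC;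
  lia.
Qed.

(** The coefficient is a residue, which integration by parts turns into the integral handled by
    [pint_adjoint]. *)
Lemma operator_genseries_polynomial k :
  pact endpoints (\sum_(i < r.+2) pact (N i) (H i)) (-1 - k%:Z) = 0.
Proof.
set B := 'X^k * endpoints; rewrite pact_coef -/B.
have -> : pact B (\sum_(i < r.+2) pact (N i) (H i)) (-1) =
    \sum_(i < r.+2) (-1) ^+ i * pint a b (((B * N i)^`(i) \Po P) * Q * p).
  rewrite pact_sumr fct_sumE; apply: eq_bigr => i _.
  by rewrite -pactM res_pact_fder res_genseries.
transitivity (pint a b ((\sum_(i < r.+2) (-1) ^+ i *: ((B * N i)^`(i) \Po P)) *
  Q * p)).
  rewrite !mulr_suml raddf_sum /=; apply: eq_bigr => i _.
  by rewrite -!scalerAl linearZ.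
apply: (pint_adjoint sP d_gt0 f0 fS lt_rd Nf); rewrite dvdp_mull //.
  exact: dvdp_mulr.
exact: dvdp_mull.
Qed.

(** The late first moment gives the sum a degree below [- 2 * r.+1], so its product with [endpoints]
    has no nonnegative exponents; [operator_genseries_polynomial] excludes the negative ones. *)
Lemma operator_genseries : \sum_(i < r.+2) pact (N i) (H i) = 0.
Proof.
have numeric := numeric_operator (d := d) (r := r.+1) (e := e)
  (s := (\sum_j J j)%N) (N := n0.+1) isT lt_rd isT sumJZ n0_eZ n0_dZ.
have deg : fdeg_le (\sum_(i < r.+2) pact (N i) (H i)) (- 1 - 2 * r.+1%:Z).
  apply: (big_ind (fun h => fdeg_le h _)); [by [] | by move=> *;
    apply: fdeg_leD|].
  move=> i _; have le_i : (i <= r.+1)%N by rewrite -ltnS.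
  have Ni : wdeg 1 (N i) (n0%:Z + i%:Z - 2 * r.+1%:Z).
    apply: (wdeg_floor (Nw le_i)); rewrite sumJE; have := sum_tower_deg r.+1.
    by move: numeric; rewrite /tower_deg mE !intS; lia.
  have := fdeg_le_pact Ni (@fdeg_H i); congr (fdeg_le _ _); lia.
apply: (pact_eq0 _ deg (A := endpoints)).
  by rewrite monic_neq0 // monicMl ?monic_exp ?monicXsubC.
apply/funext => -[k|k]; last first.
  by have := operator_genseries_polynomial k; congr (pact _ _ _ = 0); lia.
by apply: (fdeg_le_pact wdeg_endpoints deg); lia.
Qed.


(** If [g] is the sum of the [(c i \Po P) * delta^i Q], then [evalP c] is [p ^+ m * g] and [evalH c]
    is [phi g]. *)
Definition evalP (c : nat -> {poly F}) := \sum_(i < r.+1) (c i \Po P) * f i.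
Definition evalH (c : nat -> {poly F}) := \sum_(i < r.+1) pact (c i) (H i).

Let Delta := minorP P f J.
Let nu := (size Delta).-1.

(** So [nabla r N c] represents [(Delta \Po P) * delta g] when [c] represents [g]; [evalH_nabla] is
    the counterpart for [phi g]. *)
Lemma evalP_nabla c :
  p ^+ 2 * evalP (nabla r N c) = (Delta \Po P) * logder p m (evalP c).
Proof.
have act := act_nabla (V := {poly F}) (act := fun A g => (A \Po P) * g) _ _ _ Nf
  c.
rewrite /evalP act; try by move=> *;
  rewrite ?comp_polyD ?comp_polyM ?mulrDl ?mulrDr ?mulrA.
rewrite N_top -/Delta mulrCA (big_morph _ (logderD _ _) (logder0 _ _))
  mulr_sumr.
congr (_ * _); apply: eq_bigr => i _.
rewrite logderM deriv_comp -fS; last exact: leq_trans (ltn_ord i) lt_rd.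
by rewrite -/p; ring.
Qed.

Lemma evalH_nabla c : evalH (nabla r N c) = pact Delta (fder (evalH c)).
Proof.
have act := act_nabla (V := int -> F) (act := @pact F) _ _ _ operator_genseries
  c.
rewrite /evalH act; try by move=> *; rewrite ?pactD ?pactDr ?pactM.
rewrite N_top; congr (pact _ _).
have fderD : {morph @fder F : h g / h + g}.
  by move=> h g; apply/funext => n; rewrite /fder !addrfctE mulrDr.
have fder0 : fder (0 : int -> F) = 0 by apply/funext => n; rewrite /fder mulr0.
by rewrite (big_morph _ fderD fder0); apply: eq_bigr => i _; rewrite fder_pact.
Qed.

(* Cramer's rule bounds the coefficients [c] in terms of [evalP c]. *)
Lemma evalH_bound c (w v : int) : wdeg 1 (evalP c) w -> evalH c v != 0 ->
  d%:Z * v < w - m%:Z * (d%:Z - 1).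
Proof.
move=> cw; rewrite ltNge => /eqP nz; apply/negP => le_w; apply: nz.
have numeric := numeric_cramer (d := d) (r := r.+1) (e := e)
  (s := (\sum_j J j)%N) (N := n0.+1) isT lt_rd isT sumJZ n0_eZ n0_dZ.
(* If the inequality fails, Cramer's rule gives [c i] degree at most [v + n0 + i], while [H i] has
   degree at most [- n0 - 1 - i]. *)
suff : fdeg_le (evalH c) (v - 1) by apply; lia.
apply: (big_ind (fun h => fdeg_le h _)); [by [] | by move=> *;
  apply: fdeg_leD|].
move=> i _; have le_i : (i <= r)%N by rewrite -ltnS.
have ci : wdeg 1 (c i) (v + n0%:Z + i%:Z).
  have Dc : wdeg d (Delta * c i)
      (\sum_(k < r.+1) tower_deg k - tower_deg i + w - \sum_j (J j)%:Z).
    apply: (wdeg_cramer sP d_gt0 (f := f) (x := tower_deg)) => // k le_k.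
    by apply: wdeg_tower; apply: leq_trans lt_rd; rewrite leqW.
  have := wdeg_mul_cancel Delta_neq0 Dc.
  move/wdeg_floor; apply; rewrite sumJE; have := sum_tower_deg r.
  by move: numeric le_w; rewrite /tower_deg mE !intS; nia.
have := fdeg_le_pact ci (@fdeg_H i); congr (fdeg_le _ _); lia.
Qed.

Let coef_p : p`_d.-1 = P`_d * d%:R.
Proof. by rewrite coef_deriv prednK // mulr_natr. Qed.

Let coefXderiv (G : {poly F}) k : ('X * G^`())`_k = k%:R * G`_k.
Proof. by rewrite coefXM coef_deriv; case: k => [|k];
  rewrite ?mul0r //= mulr_natl. Qed.

Let sizeXderiv (G : {poly F}) k : (size G <= k.+1)%N -> (size ('X * G^`())%R <=
  k.+1)%N.
Proof.
move=> sG; apply/leq_sizeP => j lt_kj; rewrite coefXderiv nth_default ?mulr0 //.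
exact: leq_trans lt_kj.
Qed.

(* [t d/dt] multiplies the leading coefficient of [G / p ^+ m], as a function of
   [z], by its degree in [t]; subtracting this multiple lowers the degree. *)
Lemma wdeg_euler G (w : int) : wdeg 1 G w ->
  wdeg 1 (P * logder p m G -
    (((w - m%:Z * (d%:Z - 1))%:~R / d%:R) *: (p ^+ 2 * G))) (w + 2 * d%:Z - 3).
Proof.
move=> Gw; set c := _ / _.
have -> : w + 2 * d%:Z - 3 = w + 2 * (d%:Z - 1) - 1 by ring.
apply: wdeg_coef0.
  apply: wdegD; first by apply: wdeg_le (wdegM wdegP (wdeg_logder Gw)) _; lia.
  by apply: wdegN; apply: wdegZ; apply: wdeg_le (wdegM (@wdegpX 2%N) Gw) _; lia.
move=> k kE; have [w_lt0|w_ge0] := ltP w 0.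
  have -> : G = 0 by apply/polyP => j; rewrite coef0 (wdeg_coef_gt Gw) //; lia.
  by rewrite /logder deriv0 !mul0r mul0rn mulr0 scaler0 !subr0 mulr0 coef0.
have [g gE] : exists g : nat, w = g by exists `|w|%N; lia.
have sG : (size G <= g.+1)%N.
  by apply/leq_sizeP => j lt_gj; apply: (wdeg_coef_gt Gw); rewrite gE; lia.
have -> : k = (d.-1 + d.-1 + g)%N by lia.
have sp1 : (size p <= d.-1.+1)%N by rewrite sp prednK.
have sPd : (size P <= d.+1)%N by rewrite sP.
have -> : (P * logder p m G - c *: (p ^+ 2 * G))`_(d.-1 + d.-1 + g) =
    ('X * (P * logder p m G - c *: (p ^+ 2 * G)))`_(d + d.-1 + g).
  by rewrite coefXM; have -> : (d + d.-1 + g = (d.-1 + d.-1 + g).+1)%N by lia.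
have -> : 'X * (P * logder p m G - c *: (p ^+ 2 * G)) =
    P * p * ('X * G^`()) - P * ('X * p^`()) * G *+ m - c *: ('X * (p ^+ 2 * G)).
  by rewrite /logder -!mul_polyC; ring.
have sPp : (size (P * p)%R <= (d + d.-1).+1)%N.
  by rewrite (leq_trans (size_polyMleq _ _)) // sP sp; lia.
have sPp' : (size (P * ('X * p^`()))%R <= (d + d.-1).+1)%N.
  rewrite (leq_trans (size_polyMleq _ _)) // sP addSn /=.
  by rewrite -addnS leq_add2l sizeXderiv.
have spp : (size (p ^+ 2)%R <= (d.-1 + d.-1).+1)%N by rewrite -[size _]prednK
  ?size_p2 ?size_poly_gt0 ?expf_neq0 //; lia.
rewrite !coefB coefMn coefZ coefM_top ?sizeXderiv // coefM_top // coefM_top //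
  coefM_top ?sizeXderiv //.
have -> : ('X * (p ^+ 2 * G))`_(d + d.-1 + g) = (p ^+ 2 * G)`_(d.-1 + d.-1 + g).
  by rewrite coefXM; have -> : (d + d.-1 + g = (d.-1 + d.-1 + g).+1)%N by lia.
rewrite coefM_top // expr2 coefM_top // !coefXderiv coef_p.
have dE : d.-1%:R = d%:R - 1 :> F by rewrite -subn1 natrB.
rewrite /c gE dE intrB intrM intrB -!pmulrn.
have d0 : d%:R != 0 :> F by rewrite pnatr_eq0 -lt0n.
 by field.
Qed.

(** The new [c'] represents [(Delta \Po P) * (t d/dt - x) g], with [x] the bound on the degree of
    [g] in [t]. The factor [Delta] keeps coefficients polynomial, at the cost of [nu] in [t] and
    [d * nu] in [z]. The operator gains 1 in [z] and multiplies the coefficient of [phi g] at [v] by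
    [v - x], nonzero by [evalH_bound]. *)
Lemma euler_step c (w v : int) :
  wdeg 1 (evalP c) w -> fdeg_le (evalH c) v -> evalH c v != 0 ->
  exists c', [/\ wdeg 1 (evalP c') (w + d%:Z * nu%:Z - 1),
    fdeg_le (evalH c') (v + nu%:Z) & evalH c' (v + nu%:Z) != 0].
Proof.
move=> cw cv nz; have lt_v := evalH_bound cw nz.
pose x : F := (w - m%:Z * (d%:Z - 1))%:~R / d%:R.
pose c' i := 'X * nabla r N c i - x *: (Delta * c i).
have c'P : p ^+ 2 * evalP c' =
    (Delta \Po P) * (P * logder p m (evalP c) - x *: (p ^+ 2 * evalP c)).
  have -> : evalP c' = P * evalP (nabla r N c) - x *: ((Delta \Po P) * evalP c).
    rewrite /evalP !mulr_sumr scaler_sumr -sumrB; apply: eq_bigr => i _.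
    by rewrite /c' comp_polyB comp_polyZ !comp_polyM comp_polyX mulrBl -scalerAl
      !mulrA.
  rewrite mulrBr mulrCA evalP_nabla -!mul_polyC; ring.
pose h := pact 'X (fder (evalH c)) + pact (- x)%:P (evalH c).
have c'H : evalH c' = pact Delta h.
  have -> : evalH c' = pact 'X (evalH (nabla r N c)) + pact (- (x *: Delta))
    (evalH c).
    rewrite /evalH !pact_sumr -big_split; apply: eq_bigr => i _ /=.
    by rewrite -!pactM -pactD /c' -!mul_polyC; congr (pact _ _); ring.
  rewrite evalH_nabla /h pactDr -!pactM (mulrC 'X); congr (_ + pact _ _).
  by rewrite polyCN mulrN mulrC mul_polyC.
have hE n : h n = (n%:~R - x) * evalH c n.
  by rewrite /h addrfctE pactC -['X]mul1r pactMX pact1 /fder subrK mulrBl mulNr.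
have hv : fdeg_le h v by move=> n lt_n; rewrite hE cv ?mulr0.
exists c'; split.
- have sDP : (size (Delta \Po P) <= (d * nu).+1)%N.
    by rewrite (leq_trans (size_comp_poly_leq _ _)) // sP mulnC.
  have := wdegM (wdeg_size sDP) (wdeg_euler cw); rewrite -c'P.
  move/(wdeg_mul_cancel (expf_neq0 2 p_neq0)); rewrite size_p2.
  by move=> H2; apply: wdeg_le H2 _; rewrite !PoszM; lia.
- by rewrite c'H addrC; apply: fdeg_le_pact hv; apply: wdeg_size; rewrite /nu;
  case: (size _).
rewrite c'H addrC pact_top // hE !mulf_neq0 ?lead_coef_eq0 // subr_eq0.
apply/eqP => vx; move: lt_v; rewrite -(ltr_int F) intrM vx /x.
by rewrite mulrC -pmulrn divfK ?ltxx // pnatr_eq0 -lt0n.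
Qed.

Lemma euler_iterate k : exists c,
  [/\ wdeg 1 (evalP c) (tower_deg 0 + k%:Z * (d%:Z * nu%:Z - 1)),
    fdeg_le (evalH c) (- n0%:Z - 1 + k%:Z * nu%:Z)
    & evalH c (- n0%:Z - 1 + k%:Z * nu%:Z) != 0].
Proof.
elim: k => [|k [c [cw cv nz]]].
  exists (fun i => (i == 0%N)%:R); rewrite !mul0r !addr0.
  have -> : evalP (fun i => (i == 0%N)%:R) = f 0.
    rewrite /evalP big_ord_recl /= -polyC1 comp_polyC mul1r big1 ?addr0 // => i
      _.
    by rewrite -polyC0 comp_polyC mul0r.
  have -> : evalH (fun i => (i == 0%N)%:R) = genseries.
    rewrite /evalH big_ord_recl /= pact1 big1 ?addr0 // => i _.
    by rewrite pact0.
  split; [exact: wdeg_tower | exact: fdeg_genseries |].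
  by have -> : - n0%:Z - 1 = Negz n0 by lia.
have [c' [c'w c'v nz']] := euler_step cw cv nz; exists c'.
have Ew : tower_deg 0 + k.+1%:Z * (d%:Z * nu%:Z - 1) =
    tower_deg 0 + k%:Z * (d%:Z * nu%:Z - 1) + d%:Z * nu%:Z - 1 by rewrite intS;
      ring.
have Ev : - n0%:Z - 1 + k.+1%:Z * nu%:Z = - n0%:Z - 1 + k%:Z * nu%:Z + nu%:Z.
  by rewrite intS; ring.
by rewrite Ew Ev.
Qed.

Lemma core_contradiction : False.
Proof.
(* Each step narrows the gap in [evalH_bound] by 1; it is [e + d * n0.+1] at the start. *)
pose k := (e + d * n0.+1)%N.
have [c [cw _ nz]] := euler_iterate k; have := evalH_bound cw nz.
rewrite /tower_deg /k PoszD PoszM intS; lia.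
Qed.

End Core.

(** The maximum with 1 takes effect only for [d = 1], where its other entry is 0. *)
Theorem moment_index_bound (F : numFieldType) (a b : F) (P Q : {poly F})
    (d e n : nat) :
  size P = d.+1 -> (0 < d)%N -> (size Q <= e.+1)%N ->
  (forall k, (k < n)%N -> pint a b (P ^+ k * Q * P^`()) = 0) ->
  pint a b (P ^+ n * Q * P^`()) != 0 ->
  (n < e + maxn 1 (3 * d.-1 ^ 2))%N.
Proof.
move=> sP d_gt0 sQ mom0 mom_n; rewrite ltnNge; apply/negP => le_n.
have [f f0 fS] := exists_deriv_tower P^`() Q d.
have f0_neq0 : f 0 != 0.
  rewrite f0 mulf_neq0 ?expf_neq0 //.
    by rewrite -size_poly_gt0 (size_deriv_num sP).
  by apply: contraNneq mom_n => ->; rewrite mulr0 mul0r raddf0.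
have [r [lt_rd [J nzJ dep]]] := exists_rank sP d_gt0 f0_neq0.
have [|N [Nf N_top Nw]] := syzygy sP d_gt0 J (x := tower_deg d e) dep.
  by move=> i le_i; apply: (wdeg_tower sP d_gt0 sQ f0 fS);
    apply: leq_trans lt_rd.
apply: (core_contradiction sP d_gt0 sQ f0 fS lt_rd nzJ Nf N_top Nw mom0 mom_n).
  by lia.
by lia.
Qed.

(** * From polynomial integrals to the Bautin indices *)

Lemma Rintegral_deriv_poly (R : realType) (g : {poly R}) :
  \int[lebesgue_measure]_(t in `[0%R, 1%R]%classic) (g^`()).[t] = g.[1] - g.[0].
Proof.
rewrite /Rintegral (@continuous_FTC2 R _ (horner g)) //.
- by apply: continuous_subspaceT => x; apply: continuous_horner.
- split.
  + by move=> x _; apply: derivable_horner.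
  + by apply: cvg_at_right_filter; apply: continuous_horner.
  + by apply: cvg_at_left_filter; apply: continuous_horner.
- by move=> x _; rewrite derive1E; apply: derive_val.
Qed.

Section RealParts.
Variables (R : realType) (phi : R[i] -> R).
Hypotheses (phiD : forall x y, phi (x + y) = phi x + phi y)
  (phiZ : forall x r, phi (x * r%:C%C) = phi x * r).

Let phi0 : phi 0 = 0.
Proof. by apply: (addrI (phi 0)); rewrite -phiD !addr0. Qed.

(** With [phi] the real or imaginary part, this is the real polynomial that agrees with [phi] of [W]
    on real arguments, to which the real fundamental theorem of calculus applies. *)
Definition part_poly (W : {poly R[i]}) := \poly_(i < size W) phi W`_i.

Lemma coef_part_poly W i : (part_poly W)`_i = phi W`_i.
Proof. by rewrite coef_poly; case: ltnP => // le_W;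
  rewrite nth_default ?phi0. Qed.

Lemma horner_part_poly W t : (part_poly W).[t] = phi W.[t%:C%C].
Proof.
rewrite (horner_coef_wide _ (size_poly _ _)) horner_coef (big_morph _ phiD
  phi0).
by apply: eq_bigr => i _; rewrite coef_part_poly -rmorphXn phiZ.
Qed.

Lemma deriv_part_poly W : (part_poly W)^`() = part_poly W^`().
Proof.
apply/polyP => i; rewrite coef_deriv !coef_part_poly coef_deriv.
by move: (W`_i.+1) => w; elim: i.+1 => [|n IH];
  rewrite ?mulr0n ?phi0 // !mulrS phiD IH.
Qed.

Lemma Rintegral_part W :
  \int[lebesgue_measure]_(t in `[0%R, 1%R]%classic) phi (W^`().[t%:C%C])
    = phi W.[1] - phi W.[0].
Proof.
under eq_Rintegral do rewrite -horner_part_poly -deriv_part_poly.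
by rewrite Rintegral_deriv_poly !horner_part_poly rmorph1 rmorph0.
Qed.

End RealParts.

Lemma segment_integral_poly (R : realType) (a b : R[i]) (G : {poly R[i]}) :
  segment_integral a b (fun z => G.[z]) = pint a b G.
Proof.
rewrite /segment_integral /pint.
pose W := primitive G \Po (a%:P + (b - a) *: 'X).
have EW t : G.[a + t%:C%C * (b - a)] * (b - a) = W^`().[t%:C%C].
  rewrite /W deriv_comp deriv_primitive derivD derivC add0r derivZ derivX.
  by rewrite alg_polyC hornerM horner_comp hornerD hornerZ hornerX !hornerC
    (mulrC t%:C%C).
have [W0 W1] : W.[0] = (primitive G).[a] /\ W.[1] = (primitive G).[b].
  rewrite /W !horner_comp !hornerD !hornerZ !hornerX !hornerC mulr0 mulr1 addr0.
  by split; last by rewrite addrC subrK.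
rewrite /integral01; under eq_Rintegral do rewrite EW.
under [X in (_ +i* X)%C]eq_Rintegral do rewrite EW.
rewrite !Rintegral_part; try by [case=> ? ? [] | move=> [? ?] ? /=; ring].
by rewrite W0 W1; case: (_.[a]); case: (_.[b]).
Qed.

Lemma moment_pint (R : realType) (a b : R[i]) (P Q : {poly R[i]}) k :
  moment a b P Q k = pint a b (P ^+ k * Q * P^`()).
Proof.
rewrite -segment_integral_poly /moment; congr segment_integral.
by apply/funext => z; rewrite !hornerE.
Qed.

Lemma moment_tilde_pint (R : realType) (a b : R[i]) (P q : {poly R[i]}) k :
  moment_tilde a b P q k = pint a b (P ^+ k * q).
Proof.
rewrite -segment_integral_poly /moment_tilde; congr segment_integral.
by apply/funext => z; rewrite !hornerE.
Qed.

Lemma vanishing_indexP (R : realType) (m : nat -> R[i]) n :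
  vanishing_index m = Some n -> m n != 0 /\ forall k, (k < n)%N -> m k = 0.
Proof.
rewrite /vanishing_index; case: pselect => // ex [<-].
case: ex_minnP => k mk min_k; split=> // j lt_jk; apply/eqP.
by apply: contraTT lt_jk => /min_k; rewrite leqNgt.
Qed.

Lemma bautin_index_le (R : realType)
    (mom : {poly R[i]} -> {poly R[i]} -> nat -> R[i]) (d1 d2 : nat) (B : R) : 0
      <= B ->
  (forall (f g : {poly R[i]}) n,
    (size f <= d1.+1)%N -> (size g <= d2.+1)%N -> mom f g n != 0 ->
    (forall k, (k < n)%N -> mom f g k = 0) -> n.+1%:R <= B) ->
  (bautin_index mom d1 d2 <= B%:E)%E.
Proof.
move=> B0 le_B; apply: ge_ereal_sup => x [->|[f [g [n [sf sg
  /vanishing_indexP[nz z] ->]]]]].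
  by rewrite lee_fin.
by rewrite lee_fin; apply: (le_B f g).
Qed.

Lemma size_le1_or (F : numFieldType) (P : {poly F}) d : (size P <= d.+1)%N ->
  P = (P`_0)%:P \/ exists2 d', size P = d'.+1 & (0 < d' <= d)%N.
Proof.
case: (leqP (size P) 1) => [/size1_polyC|]; first by left.
case: (size P) => [|[|d']] // _ le_d; right; exists d'.+1 => //.
Qed.

Lemma bound_natr (R : realType) (c d : nat) : (0 < d)%N ->
  (c + 3 * d.-1 ^ 2)%:R = c%:R + 3 * (d%:R - 1) ^+ 2 :> R.
Proof. by move=> d_gt0; rewrite natrD natrM natrX -subn1 natrB. Qed.

(* Replacing [q] by its primitive [Q] vanishing at [a]: if the zeroth moment of
   [q] vanishes then [Q] also vanishes at [b], and integration by parts has no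
   boundary terms. *)
Lemma exists_primitive_moment (F : numFieldType) (a b : F) (P q : {poly F}) dq :
  (size q <= dq.+1)%N -> pint a b q = 0 ->
  exists2 Q : {poly F}, (size Q <= dq.+2)%N & forall k,
    pint a b (P ^+ k.+1 * q) = - (k.+1%:R * pint a b (P ^+ k * Q * P^`())).
Proof.
move=> sq q0; pose Q := primitive q - (primitive q).[a]%:P.
have Qa : Q.[a] = 0 by rewrite hornerD hornerN hornerC subrr.
have Qb : Q.[b] = 0 by rewrite hornerD hornerN hornerC; apply: q0.
exists Q => [|k].
  rewrite (leq_trans (size_polyD _ _)) // geq_max (leq_trans (size_poly _ _))
    //.
  by rewrite size_polyN (leq_trans (size_polyC_leq1 _)).
have /eqP : pint a b (P ^+ k.+1 * Q)^`() = 0.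
  by rewrite pint_deriv !hornerM Qa Qb !mulr0 subrr.
have -> : (P ^+ k.+1 * Q)^`() = k.+1%:R *: (P ^+ k * Q * P^`()) + P ^+ k.+1 * q.
  rewrite derivM deriv_exp derivB deriv_primitive derivC subr0 scaler_nat; ring.
by rewrite raddfD /= linearZ /= addrC addr_eq0 => /eqP.
Qed.

Theorem theorem1 (R : realType) (a b : R[i]%C) :
  (forall dP dQ : nat, dP <> 1%N ->
    (moment_bautin_index dP dQ a b
       <= (dQ%:R + 3 * (dP%:R - 1) ^+ 2)%:E)%E) /\
  (forall dP dq : nat,
    (moment_tilde_bautin_index dP dq a b
       <= (2 + dq%:R + 3 * (dP%:R - 1) ^+ 2)%:E)%E).
Proof.
split=> [dP dQ dP_neq1|dP dq]; apply: bautin_index_le.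
- by apply: addr_ge0; rewrite ?ler0n // mulr_ge0 ?ler0n ?sqr_ge0.
- move=> P Q n sP sQ; rewrite moment_pint => nz z.
  have [EP|[d Ed /andP[d_gt0 le_d]]] := size_le1_or sP.
    by case/eqP: nz; rewrite EP derivC mulr0 raddf0.
  rewrite -bound_natr ?(leq_trans d_gt0) // ler_nat.
  have lt_n := moment_index_bound Ed d_gt0 sQ _ nz.
  apply: leq_trans (lt_n _) _; first by move=> k /z; rewrite moment_pint.
  have le_dP : (d.-1 <= dP.-1)%N by lia.
  (* As [dP] is not 1, [3 * dP.-1 ^ 2] absorbs the 1 in the maximum. *)
  have dP_gt1 : (0 < dP.-1)%N by lia.
  rewrite leq_add2l geq_max leq_mul2l leq_exp2r // le_dP orbT andbT.
  by rewrite (@leq_trans (3 * 1 ^ 2)) // leq_mul2l leq_exp2r.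
- by do 2?[apply: addr_ge0]; rewrite ?ler0n // mulr_ge0 ?ler0n ?sqr_ge0.
move=> P q [|n] sP sq; rewrite moment_tilde_pint => nz z.
  have : 0 <= 3 * (dP%:R - 1) ^+ 2 :> R by rewrite mulr_ge0 ?ler0n ?sqr_ge0.
  have : 0 <= dq%:R :> R by rewrite ler0n.
  lra.
have z' k : (k < n.+1)%N -> pint a b (P ^+ k * q) = 0.
  by move=> /z; rewrite moment_tilde_pint.
have q0 : pint a b q = 0 by have := z' 0%N isT; rewrite expr0 mul1r.
(* For constant [P], all moments are multiples of the zeroth, which vanishes. *)
have [EP|[d Ed /andP[d_gt0 le_d]]] := size_le1_or sP.
  by case/eqP: nz; rewrite EP -polyC_exp mul_polyC linearZ /= q0 mulr0.
rewrite -natrD -bound_natr ?(leq_trans d_gt0) // ler_nat.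
have le_dP : (d.-1 <= dP.-1)%N by lia.
(* For [d = 1] passing to a primitive would lose 1; but the derivative of [P] is a constant, so
   these moments are proportional to those of the first kind for the pair [P], [q]. *)
have [d1|d_neq1] := eqVneq d 1%N.
  have [c c0 Ec] : exists2 c, c != 0 & P^`() = c%:P.
    have := size_deriv_num Ed d_gt0; rewrite d1 => /eqP/size_poly1P[c c0 ->].
    by exists c.
  have pintc k : pint a b (P ^+ k * q * P^`()) = c * pint a b (P ^+ k * q).
    by rewrite Ec mulrC mul_polyC linearZ.
  have := moment_index_bound (a := a) (b := b) (n := n.+1) Ed d_gt0 sq.
  rewrite pintc mulf_neq0 // d1 => H; apply: leq_trans (H _ isT) _.
    by move=> k /z' zk; rewrite pintc zk mulr0.
  by rewrite /maxn /=; lia.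
(* The primitive raises the degree by 1 and lowers the index by 1, whence the 2 in the bound. *)
have [Q sQ EQ] := exists_primitive_moment P sq q0.
have := moment_index_bound (a := a) (b := b) (n := n) Ed d_gt0 sQ.
have nzQ : pint a b (P ^+ n * Q * P^`()) != 0.
  by apply: contraNneq nz => n0; rewrite EQ n0 mulr0 oppr0.
rewrite nzQ => H.
have le_2 : (d.-1 ^ 2 <= dP.-1 ^ 2)%N by rewrite leq_exp2r.
have lt1 : (1 <= d.-1 ^ 2)%N by rewrite expn_gt0; lia.
have := H _ isT; rewrite (maxn_idPr _); last by lia.
move=> lt_n; apply: leq_trans (_ : (dq.+1 + 3 * d.-1 ^ 2).+1 <= _)%N;
  last by lia.
rewrite ltnS; apply: lt_n => k lt_k; have /eqP := z' k.+1 lt_k.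
by rewrite EQ oppr_eq0 mulf_eq0 pnatr_eq0 /= => /eqP.
Qed.
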